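(* Let $X$ be a multiplicity graph of total multiplicity $n$, with lift $X'$ and projection $\pi:V(X')\to V(X)$. For bijections $\sigma,\tau:[n]\to V(X')$, the arrangements $\pi\circ\sigma$ and $\pi\circ\tau$ lie in the same connected component of $\mathsf{FS}_m(\mathsf{Cycle}_n,X)$ if and only if $\alpha_{\overline{X'}}(\sigma)\approxeq\alpha_{\overline{X'}}(\tau)$.
   Context: A multiplicity graph is a simple graph $X$ with multiplicities $c_v\in\mathbb{Z}_{>0}$, total multiplicity $\sum c_v$. Its lift $X'$ is the simple graph on $\bigsqcup_v S_v$, $|S_v|=c_v$, each $S_v$ a clique and $u'\in S_u,v'\in S_v$ ($u\ne v$) adjacent iff $uv\in E(X)$; $\pi$ maps $S_v$ to $v$; $\overline{X'}$ is the complement of $X'$. $\mathsf{Cycle}_n$ is the cycle on $[n]$ with edges $\{i,i+1\}$ and $\{n,1\}$. $\mathsf{FS}_m(\mathsf{Cycle}_n,X)$ has as vertices the functions $f:[n]\to V(X)$ with $|f^{-1}(v)|=c_v$, with $f,g$ adjacent if $f=g\circ(a\ b)$ for an edge $ab$ of $\mathsf{Cycle}_n$ with $f(a)f(b)\in E(X)$. For a bijection $\sigma:[n]\to V(G)$, $\alpha_G(\sigma)$ is the acyclic orientation of $G$ with $u\to v$ iff $\sigma^{-1}(u)<\sigma^{-1}(v)$. Let $\mathfrak{S}_X$ be the group of permutations $\rho$ of $V(X')$ with $\rho(S_v)=S_v$ for all $v$; acyclic orientations $\alpha,\beta$ of $\overline{X'}$ are permutation equivalent ($\alpha\equiv\beta$)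 if some $\rho\in\mathfrak{S}_X$ satisfies $u\to_\alpha v\iff\rho(u)\to_\beta\rho(v)$. A source (sink) of an orientation is a vertex all of whose incident edges point away from (towards) it. A double flip on $\alpha$ takes two non-adjacent vertices $u,v$ with $u$ a source and $v$ a sink and reverses all edges incident to $u$ or $v$; $\alpha\approx\beta$ (double flip equivalence) if one is obtained from the other by a sequence of double flips. $\alpha\approxeq\beta$ if there is a sequence $\alpha=\alpha_0,\alpha_1,\dots,\alpha_s=\beta$ of acyclic orientations of $\overline{X'}$ in which each consecutive pair satisfies $\alpha_i\approx\alpha_{i+1}$ or $\alpha_i\equiv\alpha_{i+1}$. *)

(* Defs.v *)
From Stdlib Require Import Relation_Operators.
From mathcomp Require Import all_boot fingroup perm.

Set Implicit Arguments.
Unset Strict Implicit.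
Unset Printing Implicit Defensive.

Record sgraph (T : finType) := SGraph {
  adj :> rel T;
  adj_sym : symmetric adj;
  adj_irr : irreflexive adj }.

Section Complement.
Variables (T : finType) (G : sgraph T).

Definition compl_rel : rel T := fun u v => (u != v) && ~~ G u v.

Fact compl_rel_sym : symmetric compl_rel.
Proof. by move=> u v; rewrite /compl_rel eq_sym adj_sym. Qed.

Fact compl_rel_irr : irreflexive compl_rel.
Proof. by move=> u; rewrite /compl_rel eqxx. Qed.

Definition compl_graph : sgraph T := SGraph compl_rel_sym compl_rel_irr.

End Complement.

Section Cycle.
Variable n : nat.

(* The index set [n] is 'I_n = {0, ..., n-1}, and ordS is i |-> i+1 mod n.    *)
(* The condition a != b only matters for n = 1, where it removes the loop.    *)
Definition cycle_rel : rel 'I_n :=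
  fun a b => (a != b) && ((b == ordS a) || (a == ordS b)).

Fact cycle_rel_sym : symmetric cycle_rel.
Proof. by move=> a b; rewrite /cycle_rel eq_sym orbC. Qed.

Fact cycle_rel_irr : irreflexive cycle_rel.
Proof. by move=> a; rewrite /cycle_rel eqxx. Qed.

Definition cycle_graph : sgraph 'I_n := SGraph cycle_rel_sym cycle_rel_irr.

End Cycle.

(* A multiplicity graph is a graph X : sgraph V together with c : V -> nat    *)
(* such that 0 < c v for all v.                                               *)
Section Lift.
Variables (V : finType) (X : sgraph V) (c : V -> nat).

Definition lift_vertex : finType := {v : V & 'I_(c v)}.

Definition lift_proj (x : lift_vertex) : V := tag x.

Definition lift_block (v : V) : {set lift_vertex} := [set x | lift_proj x == v].

Definition lift_rel : rel lift_vertex := fun x y =>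
  (x != y) && ((lift_proj x == lift_proj y) || X (lift_proj x) (lift_proj y)).

Fact lift_rel_sym : symmetric lift_rel.
Proof.
by move=> x y; rewrite /lift_rel eq_sym adj_sym [lift_proj x == _]eq_sym.
Qed.

Fact lift_rel_irr : irreflexive lift_rel.
Proof. by move=> x; rewrite /lift_rel eqxx. Qed.

Definition lift_graph : sgraph lift_vertex := SGraph lift_rel_sym lift_rel_irr.

Definition block_perms : {set {perm lift_vertex}} :=
  [set rho : {perm lift_vertex} |
     [forall v, rho @: lift_block v == lift_block v]].

End Lift.

Section FriendsStrangers.
Variables (n : nat) (V : finType) (Y : sgraph 'I_n) (X : sgraph V).
Variable c : V -> nat.

Definition arrangement (f : {ffun 'I_n -> V}) : bool :=
  [forall v, #|[set i | f i == v]| == c v].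

Definition FSm_adj : rel {ffun 'I_n -> V} := fun f g =>
  [&& arrangement f, arrangement g &
   [exists a, exists b,
     [&& Y a b, X (f a) (f b) & f == finfun (g \o tperm a b)]]].

Definition FSm_same_component (f g : {ffun 'I_n -> V}) : bool :=
  [&& arrangement f, arrangement g & connect FSm_adj f g].

End FriendsStrangers.

(* A set of arcs; (u, v) \in a means u -> v. *)
Definition arcs (T : finType) := {set T * T}.

Section Orientations.
Variables (T : finType) (G : sgraph T).
Implicit Types (a b : arcs T) (u v w : T).

Definition orientation a : Prop := forall u v,
  if G u v then ((u, v) \in a) (+) ((v, u) \in a) else (u, v) \notin a.

Definition acyclic_orientation a : Prop :=
  orientation a /\
  forall s : seq T, path.cycle (fun u v => (u, v) \in a) s -> s = [::].

(* For bijective s this is u -> v iff s^-1 u < s^-1 v; see in_orient_of.      *)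
Definition orient_of n (s : 'I_n -> T) : arcs T :=
  [set p | G p.1 p.2 &&
     [exists i, exists j : 'I_n, [&& s i == p.1, s j == p.2 & i < j]]].

Definition source a u : Prop := forall w, G u w -> (u, w) \in a.
Definition sink a u : Prop := forall w, G u w -> (w, u) \in a.

Definition reverse_at u v a : arcs T :=
  [set p | if (p.1 \in [:: u; v]) || (p.2 \in [:: u; v])
           then (p.2, p.1) \in a else p \in a].

Definition double_flip a b : Prop := exists u v,
  [/\ u != v, ~~ G u v, source a u, sink a v & b = reverse_at u v a].

Definition double_flip_equiv : arcs T -> arcs T -> Prop :=
  clos_refl_trans (arcs T) double_flip.

Lemma in_orient_of n (s : 'I_n -> T) t u v : cancel s t -> cancel t s ->
  ((u, v) \in orient_of s) = G u v && (t u < t v).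
Proof.
move=> st ts; rewrite inE /=; congr (_ && _).
apply/existsP/idP => [[i /existsP[j /and3P[/eqP<- /eqP<-]]]|lt_uv].
  by rewrite !st.
by exists (t u); apply/existsP; exists (t v); rewrite !ts !eqxx.
Qed.

Lemma orient_of_acyclic n (s : 'I_n -> T) :
  bijective s -> acyclic_orientation (orient_of s).
Proof.
case=> t st ts; have E u v := in_orient_of u v st ts; split=> [u v|].
  rewrite !E (adj_sym G v u); case Guv: (G u v) => //=.
  case: ltngtP => // /val_inj/(can_inj ts) uv.
  by rewrite uv adj_irr in Guv.
case=> //= x p; set r := fun _ _ => _ => cyc.
suff: t x < t x by rewrite ltnn.
have /allP -> // : all (fun y => t x < t y) (rcons p x).
  apply: (@order_path_min _ (fun u v => t u < t v)) => [y u v|].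
    exact: ltn_trans.
  by apply: sub_path cyc => u v; rewrite /r E => /andP[].
by rewrite mem_rcons mem_head.
Qed.

End Orientations.

Section Equivalences.
Variables (V : finType) (X : sgraph V) (c : V -> nat).
Implicit Types a b : arcs (lift_vertex c).

Definition compl_lift : sgraph (lift_vertex c) := compl_graph (lift_graph X c).

Definition perm_equiv a b : Prop :=
  exists2 rho, rho \in block_perms c &
    forall u v, ((u, v) \in a) = ((rho u, rho v) \in b).

Definition equiv_step a b : Prop :=
  [/\ acyclic_orientation compl_lift a, acyclic_orientation compl_lift b &
      double_flip_equiv compl_lift a b \/ perm_equiv a b].

Definition combined_equiv : arcs (lift_vertex c) -> arcs (lift_vertex c) -> Prop :=
  clos_refl_trans (arcs (lift_vertex c)) equiv_step.

End Equivalences.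

(* Main.v *)
Require Import Defs.
From mathcomp Require Import all_boot fingroup perm.
From Stdlib Require Import Relation_Operators.
From mathcomp Require Import zify.

Set Implicit Arguments.
Unset Strict Implicit.
Unset Printing Implicit Defensive.

(** Swapping two people at positions [i] and [i+1] who are not adjacent in the
    complement [G] of the lift leaves the induced orientation of [G] unchanged,
    while such a swap at the positions [0] and [n-1] is exactly a double flip.
    Conversely, given a source [u] and a sink [v] of the orientation induced by
    [sigma], a bubble sort moves [u] to the front and [v] to the back, after
    which the double flip is the swap across the edge [{n-1, 0}]. Bubble sort
    also connects any two bijections inducing the same orientation. Swaps inside
    a block [S_v] and block permutations are invisible after projection. *)

(** * Effect of a position swap on the induced orientation *)

Section Bijections.
Variables (n : nat) (T : finType) (G : sgraph T).
Implicit Types (s : 'I_n -> T) (a b : 'I_n).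

Lemma bij_tperm s a b : bijective s -> bijective (s \o tperm a b).
Proof.
case=> t st ts; exists (tperm a b \o t) => x /=; first by rewrite st tpermK.
by rewrite tpermK ts.
Qed.

(** No position lies strictly between [a] and [a.+1], so the swap changes the relative order of the
    pair [s a], [s b] only, and this pair carries no arc. *)
Lemma orient_of_swap s a b : bijective s -> b = a.+1 :> nat ->
  ~~ G (s a) (s b) -> orient_of G (s \o tperm a b) = orient_of G s.
Proof.
case=> t st ts ab nG; apply/setP => -[u v].
rewrite (in_orient_of G u v st ts).
rewrite (@in_orient_of _ _ _ _ (tperm a b \o t)); first last.
- by move=> x /=; rewrite tpermK ts.
- by move=> x /=; rewrite st tpermK.
case Guv: (G u v) => //=.
have nab : ~ (t u = a /\ t v = b).
  by case=> ua vb; move: nG; rewrite -ua -vb !ts Guv.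
have nba : ~ (t u = b /\ t v = a).
  by case=> ub va; move: nG; rewrite -ub -va !ts adj_sym Guv.
have nuv : t u <> t v by move/(can_inj ts) => uv; rewrite uv adj_irr in Guv.
case: (tpermP a b (t u)) => [ua|ub|/eqP ua /eqP ub];
  case: (tpermP a b (t v)) => [va|vb|/eqP va /eqP vb] //.
- by case: nuv; rewrite ua va.
- by case: nab.
- by rewrite ua; move: va vb; rewrite -!val_eqE /=; lia.
- by case: nba.
- by case: nuv; rewrite ub vb.
- by rewrite ub; move: va vb; rewrite -!val_eqE /=; lia.
- by rewrite va; move: ua ub; rewrite -!val_eqE /=; lia.
- by rewrite vb; move: ua ub; rewrite -!val_eqE /=; lia.
Qed.

(** An edge meeting [s a] or [s b] has its other end at a position strictly between the two
    extremes, so exchanging the extremes reverses it. All other edges keep both positions. *)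
Lemma orient_of_wrap s a b : bijective s -> a = 0 :> nat -> b = n.-1 :> nat ->
  ~~ G (s a) (s b) ->
  orient_of G (s \o tperm a b) = reverse_at (s a) (s b) (orient_of G s).
Proof.
case=> t st ts a0 bn nG; apply/setP => -[u v].
rewrite (@in_orient_of _ _ _ _ (tperm a b \o t)); first last.
- by move=> x /=; rewrite tpermK ts.
- by move=> x /=; rewrite st tpermK.
rewrite [in RHS]inE /= !(in_orient_of G _ _ st ts) (adj_sym G v u) !inE.
case Guv: (G u v) => /=; last by case: ifP.
have nab : ~ (t u = a /\ t v = b).
  by case=> ua vb; move: nG; rewrite -ua -vb !ts Guv.
have nba : ~ (t u = b /\ t v = a).
  by case=> ub va; move: nG; rewrite -ub -va !ts adj_sym Guv.
have nuv : t u <> t v by move/(can_inj ts) => uv; rewrite uv adj_irr in Guv.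
have eqt x d : (x == s d) = (t x == d).
  by apply/eqP/eqP => [->|<-]; rewrite ?st ?ts.
rewrite !eqt.
have := ltn_ord (t u); have := ltn_ord (t v).
case: (tpermP a b (t u)) => [ua|ub|/eqP ua /eqP ub];
  case: (tpermP a b (t v)) => [va|vb|/eqP va /eqP vb].
- by case: nuv; rewrite ua va.
- by case: nab.
- by rewrite ua eqxx; move: va vb; rewrite -!val_eqE /=; lia.
- by case: nba.
- by case: nuv; rewrite ub vb.
- by rewrite ub eqxx orbT; move: va vb; rewrite -!val_eqE /=; lia.
- by rewrite va eqxx orbT; move: ua ub; rewrite -!val_eqE /=; lia.
- by rewrite vb eqxx !orbT; move: ua ub; rewrite -!val_eqE /=; lia.
- by rewrite (negPf ua) (negPf ub) (negPf va) (negPf vb).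
Qed.

Lemma double_flip_wrap s a b : bijective s -> a = 0 :> nat ->
  b = n.-1 :> nat -> a != b -> ~~ G (s a) (s b) ->
  double_flip G (orient_of G s) (orient_of G (s \o tperm a b)).
Proof.
move=> bs a0 bn ab nG; exists (s a), (s b); split=> //.
- by rewrite (bij_eq bs).
- case: bs => t st ts w Gw; rewrite (in_orient_of G _ _ st ts) Gw st a0 lt0n.
  apply: contraTneq Gw => tw0; suff -> : w = s a by rewrite adj_irr.
  by rewrite -(ts w); congr s; apply: val_inj; rewrite /= tw0.
- case: bs => t st ts w Gw; rewrite (in_orient_of G _ _ st ts) adj_sym Gw st /=.
  rewrite bn ltn_neqAle; have := ltn_ord (t w) => ltw.
  apply/andP; split; last by lia.
  apply: contraTneq Gw => twn; suff -> : w = s b by rewrite adj_irr.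
  by rewrite -(ts w); congr s; apply: val_inj; rewrite /= twn bn.
- exact: orient_of_wrap.
Qed.

(* Measure for bubble sort: exchanging a descent strictly decreases it. *)
Definition weight (h : 'I_n -> nat) := \sum_(i < n) (n - i) * h i.

Lemma weight_swap h a b : b = a.+1 :> nat -> h b < h a ->
  weight (h \o tperm a b) < weight h.
Proof.
move=> ab hab; have ne : b != a by rewrite -val_eqE /= ab; lia.
rewrite /weight (bigD1 a) //= (bigD1 b) //= [ltnRHS](bigD1 a) //=.
rewrite [in ltnRHS](bigD1 b) //= tpermL tpermR !addnA.
rewrite [X in _ + X < _](eq_bigr (fun i : 'I_n => (n - i) * h i)); last first.
  by move=> i /andP[ia ib]; rewrite tpermD // eq_sym.
rewrite ltn_add2r; have := ltn_ord b; rewrite ab => lbn.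
(* The two coefficients differ by one, so the swap lowers the weight by exactly [h a - h b]. *)
have -> : n - a = (n - a.+1).+1 by lia.
by rewrite !mulSn; lia.
Qed.

Lemma ndecr_ord (h : 'I_n -> nat) :
  (forall a b, b = a.+1 :> nat -> h a <= h b) ->
  forall a b, a <= b -> h a <= h b.
Proof.
move=> hS a [m]; elim: m => [|m IH] ltm /= lam.
  by apply: eq_leq; congr h; apply: val_inj; apply/eqP; rewrite /= -leqn0.
move: lam; rewrite leq_eqVlt => /predU1P[lam|lam].
  by apply: eq_leq; congr h; apply: val_inj.
by apply: leq_trans (IH (ltnW ltm) lam) _; apply: hS.
Qed.

(** Injectivity makes [h] strictly increasing, hence its inverse [g] too. A strictly increasing
    self-map never goes below the identity; this bound for [h] and for [g] gives both
    inequalities. *)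
Lemma incr_ord_id (h : 'I_n -> 'I_n) :
  injective h -> (forall a b, a <= b -> h a <= h b) -> forall a, h a = a.
Proof.
move=> ih mh.
have lemon (a b : 'I_n) : (h a <= h b) = (a <= b).
  apply/idP/idP; last exact: mh.
  apply: contraTT; rewrite -!ltnNge => lba.
  rewrite ltn_neqAle mh ?andbT; last exact: ltnW.
  by rewrite val_eqE (inj_eq ih) -val_eqE; apply: contraTneq lba => ->; rewrite ltnn.
have [g hg gh] := injF_bij ih.
have up (f : 'I_n -> 'I_n) :
    (forall a b : 'I_n, (f a <= f b) = (a <= b)) -> forall a : 'I_n, a <= f a.
  move=> mf [m]; elim: m => [|m IH] ltm //=.
  apply: leq_ltn_trans (IH (ltnW ltm)) _.
  by rewrite ltnNge mf -ltnNge.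
move=> a; apply/val_inj/eqP; rewrite eqn_leq (up h lemon a) andbT.
have lemong (x y : 'I_n) : (g x <= g y) = (x <= y) by rewrite -lemon !gh.
(* With [a] written as [g (h a)], the bound for [g] at [h a] reads [h a <= a]. *)
by rewrite -{2}(hg a); apply: (up g lemong).
Qed.

End Bijections.

(** * Arrangements as projections of bijections onto the lift *)

Section Multiplicity.
Variables (V : finType) (X : sgraph V) (c : V -> nat) (n : nat).
Notation LV := (lift_vertex c).
Notation G := (compl_lift X c).
Implicit Types (s : 'I_n -> LV) (a b : 'I_n).

Definition project s : {ffun 'I_n -> V} := finfun (@lift_proj V c \o s).

Notation reach s s' :=
  (connect (FSm_adj (cycle_graph n) X c) (project s) (project s')).

Lemma projectE s i : project s i = lift_proj (s i).
Proof. by rewrite ffunE. Qed.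

Lemma card_lift_block v : #|lift_block c v| = c v.
Proof.
have -> : lift_block c v = [set Tagged (fun w => 'I_(c w)) i | i : 'I_(c v)].
  apply/setP => -[w i]; rewrite inE /lift_proj /=; apply/eqP/imsetP => [wv|].
    by move: i; rewrite wv => i; exists i.
  by case=> j _ /(congr1 tag).
rewrite card_imset ?card_ord // => i j /eqP.
by rewrite -tag_eqE /tag_eq eqxx tagged_asE => /eqP.
Qed.

Lemma arrangement_project s : bijective s -> arrangement c (project s).
Proof.
move=> bs; apply/forallP => v; apply/eqP; rewrite -[RHS]card_lift_block.
rewrite -(on_card_preimset (f := s)); last exact: onW_bij.
by apply: eq_card => i; rewrite !inE projectE.
Qed.

Lemma compl_liftE (x y : LV) :
  G x y = (lift_proj x != lift_proj y) && ~~ X (lift_proj x) (lift_proj y).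
Proof.
rewrite /= /compl_rel /= /lift_rel; case: (eqVneq x y) => [->|_] /=.
  by rewrite eqxx.
by rewrite negb_or.
Qed.

(** A non-edge of the complement comes either from a common block, where the projection does not
    change, or from an edge of [X], where the swap is a legal move. *)
Lemma reach_swap s a b : bijective s -> cycle_graph n a b ->
  ~~ G (s a) (s b) -> reach s (s \o tperm a b).
Proof.
move=> bs cab; rewrite compl_liftE negb_and !negbK => /orP[/eqP eqab|Xab].
  suff -> : project (s \o tperm a b) = project s by apply: connect0.
  by apply/ffunP => i; rewrite !projectE /=; case: tpermP => // ->.
apply: connect1; rewrite /FSm_adj !arrangement_project //; last exact: bij_tperm.
apply/existsP; exists a; apply/existsP; exists b.
rewrite cab !projectE Xab /=; apply/eqP/ffunP => i.
by rewrite projectE ffunE /= projectE /= tpermK.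
Qed.

Lemma cycle_succ a b : b = a.+1 :> nat -> cycle_graph n a b.
Proof.
move=> ab; rewrite /= /cycle_rel -!val_eqE /= ab modn_small ?eqxx.
  by rewrite andbT; lia.
by have := ltn_ord b; lia.
Qed.

Lemma cycle_wrap a b : a = 0 :> nat -> b = n.-1 :> nat -> a != b ->
  cycle_graph n a b.
Proof.
move=> a0 bn ab; rewrite /= /cycle_rel ab -!val_eqE /= a0 bn.
by rewrite prednK ?modnn ?eqxx ?orbT //; have := ltn_ord a; lia.
Qed.

(** * From equivalent orientations to connected arrangements *)

Lemma bubble_sort (k : LV -> nat) s : bijective s ->
  (forall x y, (x, y) \in orient_of G s -> k x <= k y) ->
  exists s', [/\ bijective s', orient_of G s' = orient_of G s,
    reach s s' & forall a b, a <= b -> k (s' a) <= k (s' b)].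
Proof.
have [m] := ubnP (weight (k \o s)); elim: m s => // m IH s wm bs ks.
case: (boolP [exists a : 'I_n, exists b : 'I_n,
                (b == a.+1 :> nat) && (k (s b) < k (s a))]).
  case/existsP=> a /existsP[b /andP[/eqP ab kab]].
  (* The key [k] never drops along an arc, so two neighbours forming a descent are not joined in [G]
     and may be exchanged. *)
  have nG : ~~ G (s a) (s b).
    apply: contraL kab => Gab; rewrite -leqNgt; apply: ks.
    by have [t st ts] := bs; rewrite (in_orient_of G _ _ st ts) Gab !st ab leqnn.
  have oE := orient_of_swap bs ab nG.
  case: (IH (s \o tperm a b)); first 2 last.
  - by rewrite oE.
  - move=> s' [bs' os' rs' ks']; exists s'; split=> //; first by rewrite os'.
    exact: connect_trans (reach_swap bs (cycle_succ ab) nG) rs'.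
  - by apply: leq_trans (weight_swap (h := k \o s) ab kab) _.
  - exact: bij_tperm.
rewrite negb_exists => /forallP noD; exists s; split=> //.
apply: (ndecr_ord (h := k \o s)) => a b ab /=; rewrite leqNgt.
have := noD a; rewrite negb_exists => /forallP/(_ b).
by rewrite ab eqxx.
Qed.

(** Sort [s] with the position in [s'] as key. Every arc respects this key because the orientations
    agree, and the sorted bijection can only be [s']. *)
Lemma reach_orient_eq s s' : bijective s -> bijective s' ->
  orient_of G s = orient_of G s' -> reach s s'.
Proof.
move=> bs [t st ts] oE.
have [x y|r [br _ rr kr]] := bubble_sort (k := fun x => t x) bs.
  by rewrite oE (in_orient_of G _ _ st ts) => /andP[_ /ltnW].
suff -> : project s' = project r by [].
apply/ffunP => i; rewrite !projectE; congr lift_proj.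
rewrite -[in LHS](incr_ord_id (h := t \o r) _ kr i) /= ?ts //.
exact: inj_comp (can_inj ts) (bij_inj br).
Qed.

Lemma lift_double_flip s o : bijective s -> double_flip G (orient_of G s) o ->
  exists s', [/\ bijective s', orient_of G s' = o & reach s s'].
Proof.
move=> bs [u [v [uv nG su sv ->]]]; have [t st ts] := bs.
(* Other vertices get keys in [1..n] in the order of [s], so [u] has the unique minimum and [v] the
   unique maximum. The key is monotone along arcs since none enters the source [u] or leaves the
   sink [v]. *)
pose k x := if x == u then 0 else if x == v then n.+1 else (t x).+1.
have ku x : k x = 0 -> x = u.
  by rewrite /k; case: eqP => // _; case: eqP.
have kv x : n < k x -> x = v.
  rewrite /k; case: eqP => // _; case: eqP => // _.
  by have := ltn_ord (t x); lia.
have [x y|r [br or rr kr]] := bubble_sort (k := k) bs.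
  move=> xy; have := xy; rewrite (in_orient_of G _ _ st ts) => /andP[Gxy ltxy].
  rewrite /k; case: eqP => // xu; case: (eqVneq y u) => [yu|_].
    have := su x; rewrite -yu adj_sym Gxy => /(_ isT).
    by rewrite (in_orient_of G _ _ st ts); lia.
  case: (eqVneq x v) => [xv|_].
    have := sv y; rewrite -xv Gxy => /(_ isT).
    by rewrite (in_orient_of G _ _ st ts); lia.
  case: eqP => _; last by lia.
  by have := ltn_ord (t x); lia.
have n_gt0 : 0 < n by have := ltn_ord (t u); lia.
have lastP : n.-1 < n by rewrite prednK.
pose a := Ordinal n_gt0; pose b := Ordinal lastP.
have [q rq qr] := br.
have ra : r a = u.
  apply: ku; have := kr a (q u) (leq0n _).
  by rewrite qr {2}/k eqxx leqn0 => /eqP.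
have rb : r b = v.
  apply: kv; have := kr (q v) b.
  rewrite qr {1}/k eqxx eq_sym (negPf uv); apply.
  by rewrite /=; have := ltn_ord (q v); lia.
have ab : a != b by rewrite -(bij_eq br) ra rb.
have nGr : ~~ G (r a) (r b) by rewrite ra rb.
exists (r \o tperm a b); split; first exact: bij_tperm.
  by rewrite orient_of_wrap // ra rb or.
by apply: connect_trans rr _; apply: reach_swap => //; apply: cycle_wrap.
Qed.

Lemma lift_double_flips s o : bijective s ->
  double_flip_equiv G (orient_of G s) o ->
  exists s', [/\ bijective s', orient_of G s' = o & reach s s'].
Proof.
(* In this form of the closure steps are appended on the right, so the bijection reached so far is
   carried along by the induction. *)
move=> bs /Operators_Properties.clos_rt_rtn1_iff.
elim=> [|o1 o2 flip _ [s1 [bs1 os1 rs1]]]; first by exists s; split.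
have [|s2 [bs2 os2 rs2]] := lift_double_flip bs1 (o := o2); first by rewrite os1.
by exists s2; split=> //; apply: connect_trans rs1 rs2.
Qed.

Lemma block_permsP (rho : {perm LV}) :
  reflect (forall x, lift_proj (rho x) = lift_proj x) (rho \in block_perms c).
Proof.
rewrite inE; apply: (iffP forallP) => [bl x|bl v].
  have /eqP/setP/(_ (rho x)) := bl (lift_proj x).
  by rewrite (mem_imset _ _ perm_inj) !inE eqxx => /esym/eqP.
rewrite eqEcard card_imset ?leqnn ?andbT; last exact: perm_inj.
by apply/subsetP => _ /imsetP[x xv ->]; rewrite inE bl; rewrite inE in xv.
Qed.

Lemma lift_perm_equiv s o : bijective s -> perm_equiv (orient_of G s) o ->
  exists s', [/\ bijective s', orient_of G s' = o & reach s s'].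
Proof.
move=> bs [rho /block_permsP bl oE].
(* Relabelling by [rho] transports the orientation and stays inside each block, so the projected
   arrangement is the same. *)
have [t st ts] := bs; exists (rho \o s); split.
- by apply: bij_comp bs; exists (rho^-1)%g; [apply: permK | apply: permKV].
- apply/setP => -[u v]; rewrite -[u](permKV rho) -[v](permKV rho) -oE.
  set x := (rho^-1)%g u; set y := (rho^-1)%g v.
  rewrite (in_orient_of G _ _ st ts).
  rewrite (@in_orient_of _ _ _ _ (t \o (rho^-1)%g)); first last.
  + by move=> z /=; rewrite ts permKV.
  + by move=> i /=; rewrite permK st.
  by rewrite !compl_liftE !bl /= !permK.
- suff -> : project (rho \o s) = project s by apply: connect0.
  by apply/ffunP => i; rewrite !projectE /= bl.
Qed.

Lemma lift_combined_equiv s o : bijective s ->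
  combined_equiv X (orient_of G s) o ->
  exists s', [/\ bijective s', orient_of G s' = o & reach s s'].
Proof.
move=> bs /Operators_Properties.clos_rt_rtn1_iff.
elim=> [|o1 o2 [_ _ st] _ [s1 [bs1 os1 rs1]]]; first by exists s; split.
have [s2 [bs2 os2 rs2]] :
    exists s', [/\ bijective s', orient_of G s' = o2 & reach s1 s'].
  rewrite -os1 in st; case: st; [exact: lift_double_flips | exact: lift_perm_equiv].
by exists s2; split=> //; apply: connect_trans rs1 rs2.
Qed.

(** * From connected arrangements to equivalent orientations *)

(** Two bijections with one projection differ by the permutation [s' \o t], with [t] the inverse of
    [s], and this preserves every block. *)
Lemma combined_equiv_project_eq s s' : bijective s -> bijective s' ->
  project s = project s' -> combined_equiv X (orient_of G s) (orient_of G s').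
Proof.
move=> bs bs' eqp; apply: rt_step; split; try exact: orient_of_acyclic.
right; have [t st ts] := bs; have [t' st' ts'] := bs'.
have inj : injective (s' \o t).
  exact: inj_comp (bij_inj bs') (can_inj ts).
have blk x : lift_proj (s' (t x)) = lift_proj x.
  by rewrite -projectE -eqp projectE ts.
exists (perm inj) => [|u v]; first by apply/block_permsP => x; rewrite permE blk.
rewrite !permE (in_orient_of G _ _ st ts) (in_orient_of G _ _ st' ts').
by rewrite !compl_liftE !blk /= !st'.
Qed.

Lemma combined_equiv_swap s a b : bijective s -> cycle_graph n a b ->
  ~~ G (s a) (s b) ->
  combined_equiv X (orient_of G s) (orient_of G (s \o tperm a b)).
Proof.
move=> bs.
(* With the edge directed along the cycle, either [b] is [a.+1] and the orientation is unchanged, or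
   the edge runs from [n.-1] to [0] and the swap is a double flip. *)
wlog: a b / b = ordS a => [hw cab nG|bE /andP[ab _] nG].
  have /andP[_ /orP[/eqP|/eqP]] := cab; first by move/hw; apply.
  by move/hw; rewrite tpermC; apply; rewrite adj_sym.
have bs' := bij_tperm a b bs.
have [lta|gea] := ltnP a.+1 n.
  rewrite orient_of_swap //; first exact: rt_refl.
  by rewrite bE /= modn_small.
have an : a = n.-1 :> nat by have := ltn_ord a; lia.
have b0 : b = 0 :> nat.
  by rewrite bE /= an prednK ?modnn //; have := ltn_ord a; lia.
apply: rt_step; split; try exact: orient_of_acyclic.
left; apply: rt_step; rewrite tpermC.
by apply: double_flip_wrap => //; rewrite 1?eq_sym // adj_sym.
Qed.

Lemma combined_equiv_reach s s' : bijective s -> bijective s' ->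
  reach s s' -> combined_equiv X (orient_of G s) (orient_of G s').
Proof.
move=> bs bs' /connectP[p]; elim: p s bs => [|g p IH] s bs /=.
  by move=> _ eqp; apply: combined_equiv_project_eq.
case/andP=> /and3P[_ _ /existsP[a /existsP[b /and3P[cab Xab /eqP fE]]]] pp lp.
(* Each move lifts to the same swap of positions upstairs. The path then ends at a bijection that
   shares only its projection with [s'], which the base case handles. *)
have gE : g = project (s \o tperm a b).
  by apply/ffunP => i; rewrite projectE /= -projectE fE ffunE /= tpermK.
rewrite gE in pp lp; apply: rt_trans (IH _ (bij_tperm a b bs) pp lp).
apply: combined_equiv_swap => //.
by rewrite compl_liftE -!projectE Xab andbF.
Qed.

End Multiplicity.

Theorem theorem5p3 (V : finType) (X : sgraph V) (c : V -> nat)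
    (c_gt0 : forall v, 0 < c v) (n : nat) (hn : n = \sum_(v : V) c v)
    (sigma tau : 'I_n -> lift_vertex c)
    (hsigma : bijective sigma) (htau : bijective tau) :
  FSm_same_component (cycle_graph n) X c
    (finfun (@lift_proj V c \o sigma)) (finfun (@lift_proj V c \o tau))
  <-> combined_equiv X (orient_of (compl_lift X c) sigma)
                       (orient_of (compl_lift X c) tau).
Proof.
split=> [/and3P[_ _]|]; first exact: combined_equiv_reach.
(* The bijection [s] obtained here has the orientation of [tau] but may differ from [tau];
   [reach_orient_eq] closes this gap. *)
case/lift_combined_equiv=> // s [bs os rs].
apply/and3P; split; try exact: arrangement_project.
exact: connect_trans rs (reach_orient_eq bs htau os).
Qed.
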